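(* Let $K=\mathbb{F}_q$ be a finite field, let $s\geq 2$ and $1\leq d\leq s$ be integers, let $\mathcal{P}$ be the $d$-th hypersimplex of $\mathbb{R}^s$, let $\mathcal{C}_\mathcal{P}(d)$ be the toric code of $\mathcal{P}$ of degree $d$, and let $\delta(\mathcal{C}_\mathcal{P}(d))$ be its minimum distance. Then $$ \delta(\mathcal{C}_\mathcal{P}(d))=\begin{cases} (q-2)^d(q-1)^{s-d}&\mbox{ if }d\leq s/2,\ q\geq 3,\\ (q-2)^{s-d}(q-1)^{d}&\mbox{ if }s/2<d<s,\ q\geq 3,\\ (q-1)^{s}&\mbox{ if } d=s,\\ 1&\mbox{ if } q=2. \end{cases} $$
   Context: The $d$-th hypersimplex $\mathcal{P}$ is the convex hull in $\mathbb{R}^s$ of all points $\mathbf{e}_{i_1}+\cdots+\mathbf{e}_{i_d}$ with $1\leq i_1<\cdots<i_d\leq s$, where $\mathbf{e}_i$ is the $i$-th unit vector. Let $S=K[t_1,\ldots,t_s]$ and let $V_d$ be the set of all monomials $t^a=t_1^{a_1}\cdots t_s^{a_s}$ with $a\in\mathcal{P}\cap\mathbb{Z}^s$; equivalently, $V_d$ is the set of squarefree monomials of $S$ of degree $d$. $KV_d$ is the $K$-span of $V_d$. Let $T=(K^* )^s=\{P_1,\ldots,P_m\}$ be the affine torus. The toric code $\mathcal{C}_\mathcal{P}(d)\subset K^m$ is the image of the map $KV_d\to K^m$, $f\mapsto(f(P_1),\ldots,f(P_m))$. The minimum distance of a linear code is the minimum number of nonzero entries of a nonzero codeword. *)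

(* Defs.v *)
From mathcomp Require Import all_boot all_order all_algebra.
From mathcomp Require Import mpoly.
From mathcomp Require Import classical_sets reals.

Set Implicit Arguments.
Unset Strict Implicit.
Unset Printing Implicit Defensive.

Import Order.TTheory GRing.Theory Num.Theory.
Local Open Scope classical_set_scope.
Local Open Scope ring_scope.

Definition convex_hull (R : realType) (V : lmodType R) (A : set V) : set V :=
  [set x | exists (n : nat) (w : 'I_n -> R) (p : 'I_n -> V),
     [/\ forall i, 0 <= w i, \sum_(i < n) w i = 1,
         forall i, A (p i) & x = \sum_(i < n) w i *: p i]].

Definition linear_span (F : fieldType) (V : lmodType F) (A : set V) : set V :=
  [set x | exists (n : nat) (c : 'I_n -> F) (p : 'I_n -> V),
     (forall i, A (p i)) /\ x = \sum_(i < n) c i *: p i].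

(* A choice of indices i_1 < ... < i_d is a subset I of 'I_s with d elements;
   the matrix unit delta_mx 0 i is the i-th unit vector. *)
Definition hypersimplex (R : realType) (s d : nat) : set 'rV[R]_s :=
  convex_hull
    [set x | exists2 I : {set 'I_s}, #|I| = d & x = \sum_(i in I) delta_mx 0 i].
Arguments hypersimplex R s d _ : clear implicits.

(* The monomials t^a with a an integral point of the hypersimplex. The exponent
   ranges over natural vectors only, which loses no integral point since the
   hypersimplex lies in the nonnegative orthant. *)
Definition hypersimplex_monomials (R : realType) (K : finFieldType) (s d : nat) :
    set {mpoly K[s]} :=
  [set f | exists2 a : 'X_{1..s},
     hypersimplex R s d (\row_i (a i)%:R) & f = 'X_[a]].
Arguments hypersimplex_monomials R K s d _ : clear implicits.

Definition torus (K : finFieldType) (s : nat) : finType :=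
  {ffun 'I_s -> {unit K}}.

(* Words of length m = #|torus K s| have their coordinates indexed by the points
   of the torus themselves, instead of by an enumeration P_1, ..., P_m. *)
Definition evaluation (K : finFieldType) (s : nat) (f : {mpoly K[s]}) :
    {ffun torus K s -> K} :=
  [ffun P : torus K s => f.@[fun i => val (P i)]].

Definition toric_code (R : realType) (K : finFieldType) (s d : nat) :
    set {ffun torus K s -> K} :=
  @evaluation K s @` linear_span (hypersimplex_monomials R K s d).
Arguments toric_code R K s d _ : clear implicits.

Definition hamming_weight (K : finFieldType) (T : finType) (c : {ffun T -> K}) :
    nat :=
  #|[set j | c j != 0]%SET|.

(* delta is the least weight of a nonzero codeword; in particular, no delta
   satisfies this for the zero code. *)
Definition is_minimum_distance (K : finFieldType) (T : finType)
    (C : set {ffun T -> K}) (delta : nat) : Prop :=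
  (exists c, [/\ C c, c <> 0 & hamming_weight c = delta]) /\
  (forall c, C c -> c <> 0 -> (delta <= hamming_weight c)%N).

(* Main.v *)
(* A codeword is the evaluation of a form f = g + x_a h that is affine in each
   variable. At a point of the torus where h does not vanish, at most one value
   of x_a kills f; by induction on the degree, f has at least
   (q-2)^d (q-1)^(s-d) nonzeros. Inverting the coordinates and multiplying by
   x_1 ... x_s turns degree d into degree s - d, which gives the other bound.
   With k = min(d, s-d), both are attained by
   (x_1 - x_2) ... (x_(2k-1) - x_(2k)) x_(2k+1) ... x_(k+d). *)
Require Import Defs.
From mathcomp Require Import all_boot all_order all_algebra.
From mathcomp Require Import mpoly.
From mathcomp Require Import classical_sets reals.
From mathcomp Require Import finalg finfield zify.
(* Repeated because classical_sets shadows many lemmas on finite sets. *)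
From mathcomp Require Import fintype finset.

Set Implicit Arguments.
Unset Strict Implicit.
Unset Printing Implicit Defensive.

Import GRing.Theory Num.Theory.
Local Open Scope ring_scope.

(** * Multilinear forms on the torus and their nonzeros *)

(** A squarefree polynomial is encoded by its coefficients, indexed by the sets of variables of its
    monomials, so that degrees become cardinalities. *)
Definition multilin (K : finFieldType) (T : finType) (c : {set T} -> K)
    (P : {ffun T -> {unit K}}) : K :=
  \sum_(I : {set T}) c I * \prod_(i in I) val (P i).

(** A sum of booleans rather than a cardinality, so that counts can be reindexed, exchanged and
    averaged. *)
Definition nb_nonzero (K : finFieldType) (T : finType) (f : T -> K) : nat :=
  (\sum_x (f x != 0)%R)%N.

Definition scale_coord (K : finFieldType) (T : finType) (a : T) (u : {unit K})
    (P : {ffun T -> {unit K}}) : {ffun T -> {unit K}} :=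
  [ffun i => if i == a then (u * P i)%g else P i].

(** The form h in f = g + x_a h, where neither g nor h involves x_a; [remainder_coef] gives g. *)
Definition quotient_coef (K : finFieldType) (T : finType) (a : T)
    (c : {set T} -> K) (I : {set T}) : K :=
  if a \in I then 0 else c (a |: I).

Definition remainder_coef (K : finFieldType) (T : finType) (a : T)
    (c : {set T} -> K) (I : {set T}) : K :=
  if a \in I then 0 else c I.

(** Multiplication by x_a, for forms free of x_a: any term containing x_a would be dropped. *)
Definition product_coef (K : finFieldType) (T : finType) (a : T)
    (c : {set T} -> K) (I : {set T}) : K :=
  if a \in I then c (I :\ a) else 0.

Lemma card_units (K : finFieldType) : #|{: {unit K}}| = #|K|.-1.
Proof. by rewrite -card_finField_unit cardsT. Qed.

Lemma eq_multilin (K : finFieldType) (T : finType) (c e : {set T} -> K) P :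
  c =1 e -> multilin c P = multilin e P.
Proof. by move=> ce; apply: eq_bigr => I _; rewrite ce. Qed.

Lemma multilin0 (K : finFieldType) (T : finType) (c : {set T} -> K) P :
  (forall I, c I = 0) -> multilin c P = 0.
Proof. by move=> c0; apply: big1 => I _; rewrite c0 mul0r. Qed.

Lemma multilinB (K : finFieldType) (T : finType) (c e : {set T} -> K) P :
  multilin (fun I => c I - e I) P = multilin c P - multilin e P.
Proof. by rewrite -sumrB; apply: eq_bigr => I _; rewrite mulrBl. Qed.

Lemma nb_nonzeroE (K : finFieldType) (T : finType) (f : T -> K) :
  #|[set x | f x != 0]%SET| = nb_nonzero f.
Proof.
rewrite /nb_nonzero -sum1dep_card big_mkcond /=.
by apply: eq_bigr => x _; case: (f x != 0).
Qed.

Lemma eq_nb_nonzero (K : finFieldType) (T : finType) (f g : T -> K) :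
  f =1 g -> nb_nonzero f = nb_nonzero g.
Proof. by move=> fg; apply: eq_bigr => x _; rewrite fg. Qed.

Lemma nb_nonzero_all (K : finFieldType) (T : finType)
    (f : {ffun T -> {unit K}} -> K) :
  (forall P, f P != 0) -> nb_nonzero f = (#|K|.-1 ^ #|T|)%N.
Proof.
move=> f0; rewrite /nb_nonzero (eq_bigr (fun=> 1%N)) => [|P _]; last by rewrite f0.
by rewrite sum1_card card_ffun card_units.
Qed.

(* Scaling a coordinate by a unit permutes the torus, so a count on the torus
   may be averaged over the scalings. *)
Lemma sum_scale_coord (K : finFieldType) (T : finType) (a : T)
    (f : {ffun T -> {unit K}} -> nat) :
  (\sum_P \sum_u f (scale_coord a u P) = #|K|.-1 * \sum_P f P)%N.
Proof.
rewrite exchange_big /= (eq_bigr (fun=> \sum_P f P)%N) => [|u _].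
  by rewrite sum_nat_const card_units.
rewrite [RHS](reindex_inj (h := scale_coord a u)) //= => P Q /ffunP PQ.
apply/ffunP=> i; have := PQ i; rewrite !ffunE; case: eqP => // _.
exact: mulgI.
Qed.

(** The map I |-> a |: I is a bijection from the sets avoiding a to those containing a; it factors
    x_a out of the latter terms. *)
Lemma multilin_euclid (K : finFieldType) (T : finType) (a : T)
    (c : {set T} -> K) P :
  multilin c P =
  multilin (remainder_coef a c) P + val (P a) * multilin (quotient_coef a c) P.
Proof.
rewrite /multilin (bigID (fun I : {set T} => a \notin I)) /=; congr (_ + _).
  rewrite [RHS](bigID (fun I : {set T} => a \notin I)) /=.
  rewrite [X in _ = _ + X]big1 ?addr0 => [|I]; last first.
    by rewrite negbK /remainder_coef => ->; rewrite mul0r.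
  by apply: eq_bigr => I /negbTE aI; rewrite /remainder_coef aI.
rewrite [in RHS](bigID (fun I : {set T} => a \notin I)) /=.
rewrite [X in _ * (_ + X)]big1 ?addr0 => [|I]; last first.
  by rewrite negbK /quotient_coef => ->; rewrite mul0r.
rewrite (reindex_onto (fun I => a |: I) (fun I => I :\ a)) /=; last first.
  by move=> I; rewrite negbK; exact: setD1K.
rewrite mulr_sumr; apply: eq_big => [I|I].
  rewrite setU11; case aI: (a \in I) => /=; last by rewrite setU1K ?aI ?eqxx.
  by apply/negbTE/negP => /eqP /setP /(_ a); rewrite !inE eqxx aI.
rewrite setU11 /= => /eqP Ia; have aI: a \notin I by rewrite -Ia setD11.
by rewrite big_setU1 //= /quotient_coef (negbTE aI) mulrCA.
Qed.

Lemma multilin_scale_coord (K : finFieldType) (T : finType) (a : T)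
    (u : {unit K}) (c : {set T} -> K) P :
  (forall I : {set T}, a \in I -> c I = 0) ->
  multilin c (scale_coord a u P) = multilin c P.
Proof.
move=> c0; apply: eq_bigr => I _.
case aI: (a \in I); first by rewrite c0 // !mul0r.
congr (_ * _); apply: eq_bigr => i iI; rewrite ffunE.
by case: eqP => // ia; rewrite -ia iI in aI.
Qed.

Lemma multilin_product (K : finFieldType) (T : finType) (a : T)
    (c : {set T} -> K) P :
  (forall I : {set T}, a \in I -> c I = 0) ->
  multilin (product_coef a c) P = val (P a) * multilin c P.
Proof.
move=> c0; rewrite (multilin_euclid a) multilin0 ?add0r => [|I]; last first.
  by rewrite /remainder_coef /product_coef; case: (a \in I).
congr (_ * _); apply: eq_multilin => I; rewrite /quotient_coef /product_coef.
case: ifP => [/c0 -> //|aI].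
by rewrite setU11 setU1K ?aI.
Qed.

(** * Lower bounds on the number of nonzeros *)

(** An affine function of slope z != 0 has at most one root, and u |-> u * y is injective, so at
    most one unit u is lost. *)
Lemma leq_sum_unit_affine (K : finFieldType) (x z : K) (y : {unit K}) :
  z != 0 ->
  (#|K|.-1.-1 <= \sum_(u : {unit K}) (x + val (u * y)%g * z != 0)%R)%N.
Proof.
move=> z0; rewrite -/(nb_nonzero (fun u : {unit K} => x + val (u * y)%g * z)).
rewrite -nb_nonzeroE -card_units.
set A := [set u | _]%SET.
have : (#|~: A| <= 1)%N.
  apply/card_le1_eqP => u v; rewrite !inE !negbK => /eqP eu /eqP ev.
  apply/(mulIg y)/val_inj/(mulIf z0)/(addrI x).
  exact: etrans ev (esym eu).
have : (#|A| + #|~: A| = #|{: {unit K}}|)%N := cardsC A.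
lia.
Qed.

(** Only u = y * z^-1 is lost. The exact count is what makes the extremal forms attain the bound. *)
Lemma sum_unit_neq (K : finFieldType) (y z : {unit K}) :
  (\sum_(u : {unit K}) (val (u * z)%g - val y != 0)%R = #|K|.-1.-1)%N.
Proof.
rewrite (bigD1 (y * z^-1)%g) // mulgVK subrr eqxx /= add0n.
rewrite (eq_bigr (fun=> 1%N)) => [|u /negbTE uy].
  by rewrite sum1_card (cardC1 (y * z^-1)%g) card_units.
rewrite subr_eq0; case: eqP => // uzy.
have /val_inj uzE : val (u * z)%g = val y by [].
by rewrite -uzE mulgK eqxx in uy.
Qed.

(** With q = #|K|, the factor (q-1)^d on the right avoids a truncated exponent #|T| - d; each
    induction step spends one q-1 on averaging over the scalings of a variable. *)
Lemma multilin_lower_bound (K : finFieldType) (T : finType) (d : nat)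
    (c : {set T} -> K) :
  (forall I, c I != 0 -> (#|I| <= d)%N) -> (exists I, c I != 0) ->
  (#|K|.-1.-1 ^ d * #|K|.-1 ^ #|T| <= #|K|.-1 ^ d * nb_nonzero (multilin c))%N.
Proof.
elim: d c => [|d IHd] c cd [I0 cI0].
  rewrite !expn0 !mul1n nb_nonzero_all // => P.
  have I00: I0 = set0 by apply/eqP; rewrite -cards_eq0 -leqn0 cd.
  rewrite I00 in cI0.
  rewrite /multilin (bigD1 set0) //= big_set0 mulr1 big1 ?addr0 // => I II0.
  case: (eqVneq (c I) 0) => [-> | /cd]; first by rewrite mul0r.
  by rewrite leqn0 cards_eq0 (negbTE II0).
rewrite !expnS -!mulnA.
case: (boolP [exists I, (c I != 0) && (I != set0)]); last first.
  (* Here f is constant and has no variable to split off; the induction hypothesis applies to f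
     itself, and q-2 <= q-1 gives the extra factor. *)
  move=> /existsPn c0; apply: leq_mul; first exact: leq_pred.
  apply: IHd; last by exists I0.
  by move=> I cI; have := c0 I; rewrite cI /= negbK => /eqP ->; rewrite cards0.
(* Taking a in the support of a monomial of f ensures that the quotient by x_a is nonzero. *)
move=> /existsP [I /andP [cI /set0Pn [a aI]]].
have h0 (J : {set T}) : a \in J -> quotient_coef a c J = 0 by rewrite /quotient_coef => ->.
have r0 (J : {set T}) : a \in J -> remainder_coef a c J = 0 by rewrite /remainder_coef => ->.
have IH := IHd (quotient_coef a c) _ _.
apply: (@leq_trans (#|K|.-1.-1 * (#|K|.-1 ^ d *
    nb_nonzero (multilin (quotient_coef a c)))))%N.
  rewrite leq_mul2l IH ?orbT //.
    move=> J; rewrite /quotient_coef; case: ifP => aJ; first by rewrite eqxx.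
    by move=> /cd; rewrite cardsU1 aJ add1n.
  by exists (I :\ a); rewrite /quotient_coef setD11 setD1K.
rewrite mulnCA [leqRHS]mulnCA leq_mul2l; apply/orP; right.
(* The comparison is now made point by point: where h vanishes the left side is 0, elsewhere at
   least q-2 scalings of x_a keep f nonzero. *)
rewrite -(sum_scale_coord a) big_distrr /=; apply: leq_sum => P _.
case: (eqVneq (multilin (quotient_coef a c) P) 0) => [|hP].
  by rewrite muln0.
rewrite muln1 (leq_trans (leq_sum_unit_affine
  (multilin (remainder_coef a c) P) (P a) hP)) //.
apply: leq_sum => u _; rewrite (multilin_euclid a c (scale_coord _ _ _)).
by rewrite !multilin_scale_coord // ffunE eqxx.
Qed.

(* The inversion of the torus exchanges degrees d and #|T| - d, up to the
   nowhere vanishing monomial of all the variables. *)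
Lemma nb_nonzero_setC (K : finFieldType) (T : finType) (c : {set T} -> K) :
  nb_nonzero (multilin (fun I => c (~: I))) = nb_nonzero (multilin c).
Proof.
pose inv (P : {ffun T -> {unit K}}) : {ffun T -> {unit K}} :=
  [ffun i => (P i)^-1%g].
have invK : involutive inv by move=> P; apply/ffunP => i; rewrite !ffunE invgK.
rewrite [RHS](reindex_inj (inv_inj invK)); apply: eq_bigr => P _.
have -> : multilin (fun I => c (~: I)) P =
          (\prod_i val (P i)) * multilin c (inv P).
  rewrite /multilin mulr_sumr (reindex_inj (@setC_inj T)) /=.
  apply: eq_bigr => I _; rewrite setCK mulrCA; congr (_ * _).
  rewrite [in RHS](bigID (mem I)) /= mulrAC -big_split /=.
  rewrite [X in _ = X * _]big1 ?mul1r.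
    by apply: eq_bigl => i; rewrite inE.
  by move=> i _; rewrite ffunE; exact: (congr1 (@FinRing.uval _) (mulgV (P i))).
rewrite mulf_eq0 negb_or; suff -> : \prod_i val (P i) != 0 by [].
by apply/prodf_neq0 => i _; rewrite -unitfE (valP (P i)).
Qed.

(** The second bound is the first one applied to the complemented coefficients, homogeneous of
    degree #|T| - d. *)
Lemma homogeneous_lower_bound (K : finFieldType) (T : finType) (d : nat)
    (c : {set T} -> K) :
  (d <= #|T|)%N -> (forall I, c I != 0 -> #|I| = d) -> (exists I, c I != 0) ->
  (#|K|.-1.-1 ^ d * #|K|.-1 ^ (#|T| - d) <= nb_nonzero (multilin c))%N /\
  (#|K|.-1.-1 ^ (#|T| - d) * #|K|.-1 ^ d <= nb_nonzero (multilin c))%N.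
Proof.
move=> dT cd [I0 cI0].
have K1 : (0 < #|K|.-1)%N by rewrite -subn1 subn_gt0 finNzRing_gt1.
have bound e (b : {set T} -> K) : (e <= #|T|)%N ->
    (forall I, b I != 0 -> #|I| = e) -> (exists I, b I != 0) ->
    (#|K|.-1.-1 ^ e * #|K|.-1 ^ (#|T| - e) <= nb_nonzero (multilin b))%N.
  move=> eT be b0; rewrite -(@leq_pmul2l (#|K|.-1 ^ e)) ?expn_gt0 ?K1 //.
  rewrite mulnCA -expnD subnKC // multilin_lower_bound // => I /be -> //.
split; first by apply: bound => //; exists I0.
rewrite -{2}(subKn dT) -(nb_nonzero_setC c); apply: bound.
- exact: leq_subr.
- by move=> I /cd; rewrite cardsCs setCK => <-; rewrite subKn ?max_card.
- by exists (~: I0); rewrite setCK.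
Qed.

(** * Forms attaining the bounds *)

(** [A] records the variables already used, so that each new factor x_i - x_j takes two fresh ones.
    The product then stays squarefree, and scaling x_i leaves the other factors unchanged. *)
Lemma extremal_form (K : finFieldType) (T : finType) (k m : nat) :
  (2 * k + m <= #|T|)%N ->
  exists (A : {set T}) (c : {set T} -> K),
    [/\ #|A| = (2 * k + m)%N,
        forall I, c I != 0 -> I \subset A /\ #|I| = (k + m)%N &
        (#|K|.-1 ^ k * nb_nonzero (multilin c) =
         #|K|.-1.-1 ^ k * #|K|.-1 ^ #|T|)%N].
Proof.
elim: k => [|k IHk] kmT.
  (* For k = 0 the form is a single monomial of degree m, which vanishes nowhere on the torus. *)
  have [A Am] : exists A : {set T}, #|A| = m.
    exists [set x in take m (enum T)]%SET; rewrite cardsE.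
    have /card_uniqP -> : uniq (take m (enum T)) by rewrite take_uniq ?enum_uniq.
    by rewrite size_takel // -cardE; exact: kmT.
  exists A, (fun I => (I == A)%:R); split => //.
    by move=> I; case: (eqVneq I A) => [-> | _]; rewrite ?eqxx ?Am.
  rewrite !expn0 !mul1n nb_nonzero_all // => P.
  rewrite /multilin (bigD1 A) //= eqxx mul1r [X in _ + X]big1 ?addr0 => [|I /negbTE ->].
    by apply/prodf_neq0 => i _; rewrite -unitfE (valP (P i)).
  by rewrite mul0r.
have [|A [c [cardA cA cN]]] := IHk; first by lia.
have /card_gt1P [i [j [iA jA ij]]] : (1 < #|~: A|)%N by have := cardsC A; lia.
rewrite !inE in iA jA.
have c0 h (I : {set T}) : h \notin A -> h \in I -> c I = 0.
  move=> hA hI; apply/eqP/negPn/negP => /cA [/subsetP /(_ h hI)].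
  by rewrite (negbTE hA).
have pA h I : h \notin A -> product_coef h c I != 0 ->
    I \subset h |: A /\ #|I| = (k.+1 + m)%N.
  move=> hA; rewrite /product_coef; case: ifP => hI; last by rewrite eqxx.
  move=> /cA [sub card]; split; first by rewrite -subDset.
  by rewrite (cardsD1 h) hI card.
exists (i |: (j |: A)), (fun I => product_coef i c I - product_coef j c I).
split.
- by rewrite !cardsU1 !inE negb_or ij iA jA cardA; lia.
- move=> I; case: (eqVneq (product_coef i c I) 0) => [->|/(pA _ _ iA)].
    rewrite sub0r oppr_eq0 => /(pA _ _ jA) [sub ->]; split=> //.
    exact: subset_trans sub (subsetUr _ _).
  move=> [sub ->] _; split=> //; apply: subset_trans sub (setUS _ (subsetUr _ _)).
have cE P : multilin (fun I => product_coef i c I - product_coef j c I) P =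
    (val (P i) - val (P j)) * multilin c P.
  rewrite multilinB !multilin_product ?mulrBl // => I; exact: c0.
rewrite !expnS -!mulnA -cN [LHS]mulnCA [RHS]mulnCA; congr (_ * _)%N.
(* Averaging over the scalings of x_i: at each point exactly q-2 of them keep x_i and x_j
   distinct. *)
rewrite (eq_nb_nonzero cE) -(sum_scale_coord i) big_distrr /=.
apply: eq_bigr => P _.
rewrite -(sum_unit_neq (P j) (P i)) big_distrl /=; apply: eq_bigr => u _.
rewrite multilin_scale_coord => [|I]; last exact: c0.
rewrite !ffunE eqxx [j == i]eq_sym (negbTE ij) mulf_eq0 negb_or.
by rewrite -mulnb.
Qed.

(** * From the hypersimplex to coefficient functions *)

(** The generating points have coordinates in [0, 1] with sum d, and convex combinations keep both
    properties; integrality then forces every coordinate to be 0 or 1. *)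
Lemma hypersimplex_indicator (R : realType) (s d : nat) (a : 'X_{1..s}) :
  hypersimplex R s d (\row_i (a i)%:R) <->
  exists2 I : {set 'I_s}, #|I| = d & forall i, a i = (i \in I).
Proof.
have deltaE (I : {set 'I_s}) i :
    (\sum_(j in I) delta_mx 0 j : 'rV[R]_s) 0 i = (i \in I)%:R.
  rewrite summxE; case iI: (i \in I).
    rewrite (bigD1 i) //= mxE !eqxx big1 ?addr0 // => j /andP [_ /negbTE ji].
    by rewrite mxE eq_sym ji andbF.
  rewrite big1 // => j jI; rewrite mxE eqxx /=; case: eqP => // ij.
  by rewrite ij jI in iI.
split=> [[n [w [p [w0 w1 pA /rowP ap]]]]|[I Id aI]]; last first.
  exists 1%N, (fun=> 1), (fun=> \row_i (a i)%:R); split=> //.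
  - by rewrite big_ord1.
  - move=> _; exists I => //; apply/rowP => i; by rewrite deltaE mxE aI.
  - by rewrite big_ord1 scale1r.
have aE i : (a i)%:R = \sum_k w k * p k 0 i.
  by have := ap i; rewrite mxE summxE => ->; apply: eq_bigr => k _; rewrite mxE.
have a1 i : (a i <= 1)%N.
  rewrite -(ler_nat R) aE -w1; apply: ler_sum => k _.
  have [I _ ->] := pA k; rewrite deltaE; case: (_ \in _); rewrite ?mulr1 //.
  by rewrite mulr0.
exists [set i | a i == 1%N]%SET; last first.
  by move=> i; rewrite inE; case: (a i) (a1 i) => [|[]].
(* The cardinality is computed in R, where the coordinate sum is a convex combination of sums all
   equal to d. *)
apply/eqP; rewrite -(eqr_nat R) -sum1dep_card natr_sum; apply/eqP.
transitivity (\sum_i (a i)%:R : R).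
  rewrite big_mkcond /=; apply: eq_bigr => i _.
  by case: (a i) (a1 i) => [|[]].
rewrite (eq_bigr _ (fun i _ => aE i)) exchange_big /= -[RHS]mul1r -{1}w1 mulr_suml.
apply: eq_bigr => k _; rewrite -mulr_sumr; congr (_ * _).
have [I <- ->] := pA k; rewrite -sum1_card natr_sum [RHS]big_mkcond /=.
by apply: eq_bigr => i _; rewrite deltaE; case: (_ \in _).
Qed.

(** This reduces the code to coefficient functions supported on the d-sets, to which the counting
    results apply. *)
Lemma toric_codeE (R : realType) (K : finFieldType) (s d : nat)
    (w : {ffun torus K s -> K}) :
  toric_code R K s d w <->
  exists2 c : {set 'I_s} -> K,
    forall I, c I != 0 -> #|I| = d & w =1 multilin c.
Proof.
split=> [[_ [n [b [p [pA ->]]]] <-]|[c cd wc]].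
  (* The spanning family [p] may repeat monomials, so the coefficients are accumulated along the
     sum. *)
  pose Q (f : {mpoly K[s]}) := exists2 c : {set 'I_s} -> K,
    forall I, c I != 0 -> #|I| = d & @evaluation K s f =1 multilin c.
  apply: (big_ind Q) => [|f g [c cd fc] [e ed ge]|k _].
  - exists (fun=> 0) => [I|P]; first by rewrite eqxx.
    by rewrite ffunE meval0 multilin0.
  - exists (fun I => c I + e I) => [I|P].
      case: (eqVneq (c I) 0) => [->|/cd //]; rewrite add0r; exact: ed.
    have := fc P; have := ge P; rewrite !ffunE mevalD => -> ->.
    by rewrite /multilin -big_split; apply: eq_bigr => I _; rewrite mulrDl.
  - have [a /hypersimplex_indicator [I Id aI] ->] := pA k.
    exists (fun J => if J == I then b k else 0) => [J|P].
      by case: (eqVneq J I) => [-> //|_]; rewrite eqxx.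
    rewrite ffunE mevalZ mevalX /multilin (bigD1 I) //= eqxx.
    rewrite [X in _ = _ + X]big1 ?addr0 => [|J /negbTE ->]; last by rewrite mul0r.
    congr (_ * _); rewrite [RHS]big_mkcond /=; apply: eq_bigr => i _.
    by rewrite aI; case: (i \in I).
(* Conversely, the combination has one term for each d-set, numbered by [enum_val]. *)
pose A := [set I : {set 'I_s} | #|I| == d]%SET.
pose mon (I : {set 'I_s}) : {mpoly K[s]} :=
  'X_[[multinom (i \in I : nat) | i < s]].
exists (\sum_(k < #|A|) c (enum_val k) *: mon (enum_val k)).
  exists #|A|, (fun k => c (enum_val k)), (fun k => mon (enum_val k)); split=> // k.
  exists [multinom (i \in enum_val k : nat) | i < s] => //.
  apply/hypersimplex_indicator; exists (enum_val k).
    by have := enum_valP k; rewrite inE => /eqP.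
  by move=> i; rewrite mnmE.
apply/ffunP => P; rewrite wc ffunE raddf_sum /=.
rewrite -(big_enum_val (A := mem A) (fun I => (c I *: mon I).@[fun i => val (P i)])) /=.
rewrite big_mkcond /=; apply: eq_bigr => I _; rewrite inE.
case: eqP => [_|/eqP Id].
  rewrite mevalZ mevalX; congr (_ * _); rewrite [RHS]big_mkcond /=.
  by apply: eq_bigr => i _; rewrite mnmE; case: (i \in I).
by case: (eqVneq (c I) 0) => [->|/cd/eqP]; rewrite ?mul0r // (negbTE Id).
Qed.

(** * Minimum distance of the toric code *)

(** A product of k differences and d - k single variables has degree d and uses k + d variables. The
    values k = d, s - d and 0 serve the cases of the theorem. *)
Lemma extremal_codeword (R : realType) (K : finFieldType) (s d k : nat) :
  (k <= d)%N -> (k + d <= s)%N ->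
  exists2 w, toric_code R K s d w &
    hamming_weight w = (#|K|.-1.-1 ^ k * #|K|.-1 ^ (s - k))%N.
Proof.
move=> kd kds; have K1 : (0 < #|K|.-1)%N by rewrite -subn1 subn_gt0 finNzRing_gt1.
have [|A [c [_ cA cN]]] := @extremal_form K 'I_s k (d - k).
  by rewrite card_ord; lia.
exists [ffun P => multilin c P].
  apply/toric_codeE; exists c => [I /cA [_ ->]|P]; [lia | by rewrite ffunE].
apply/eqP; rewrite -(@eqn_pmul2l (#|K|.-1 ^ k)) ?expn_gt0 ?K1 //.
rewrite mulnCA -expnD subnKC ?(leq_trans _ kds) ?leq_addr //.
rewrite /hamming_weight nb_nonzeroE -[s in X in _ == X]card_ord -cN.
by apply/eqP; congr (_ * _)%N; apply: eq_nb_nonzero => P; rewrite ffunE.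
Qed.

Lemma codeword_lower_bound (R : realType) (K : finFieldType) (s d : nat)
    (w : {ffun torus K s -> K}) :
  (d <= s)%N -> toric_code R K s d w -> w <> 0 ->
  (#|K|.-1.-1 ^ d * #|K|.-1 ^ (s - d) <= hamming_weight w)%N /\
  (#|K|.-1.-1 ^ (s - d) * #|K|.-1 ^ d <= hamming_weight w)%N.
Proof.
move=> ds /toric_codeE [c cd wc] w0.
rewrite /hamming_weight nb_nonzeroE (eq_nb_nonzero wc).
have := @homogeneous_lower_bound K 'I_s d c; rewrite card_ord; apply=> //.
apply/existsP; apply: contra_notT w0 => /existsPn c0.
apply/ffunP => P; rewrite ffunE wc multilin0 // => I.
by apply/eqP; have := c0 I; rewrite negbK.
Qed.

Lemma hamming_weight_gt0 (K : finFieldType) (T : finType) (w : {ffun T -> K}) :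
  (0 < hamming_weight w)%N <-> w <> 0.
Proof.
split=> [|w0].
  by move=> /card_gt0P [x]; rewrite inE => /[swap] ->; rewrite ffunE eqxx.
apply/card_gt0P; apply/existsP; apply: contra_notT w0 => /existsPn w0.
by apply/ffunP => x; have := w0 x; rewrite inE negbK ffunE => /eqP.
Qed.

(** Positivity of n makes the attaining word nonzero. *)
Lemma is_minimum_distanceP (K : finFieldType) (T : finType)
    (C : set {ffun T -> K}) (n : nat) :
  (0 < n)%N -> (exists2 w, C w & hamming_weight w = n) ->
  (forall w, C w -> w <> 0 -> (n <= hamming_weight w)%N) ->
  is_minimum_distance C n.
Proof.
move=> n0 [w Cw wn] Cn; split=> //; exists w; split=> //.
by apply/hamming_weight_gt0; rewrite wn.
Qed.

Theorem theorem4p5 (R : realType) (K : finFieldType) (q s d : nat)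
    (card_K : #|K| = q) (s_ge2 : (2 <= s)%N) (d_ge1 : (1 <= d)%N)
    (d_le_s : (d <= s)%N) :
  [/\ (2 * d <= s)%N -> (3 <= q)%N ->
        is_minimum_distance (toric_code R K s d)
          ((q - 2) ^ d * (q - 1) ^ (s - d))%N,
      (s < 2 * d)%N -> (d < s)%N -> (3 <= q)%N ->
        is_minimum_distance (toric_code R K s d)
          ((q - 2) ^ (s - d) * (q - 1) ^ d)%N,
      d = s -> is_minimum_distance (toric_code R K s d) ((q - 1) ^ s)%N
    & q = 2%N -> is_minimum_distance (toric_code R K s d) 1%N].
Proof.
have q1 : (q - 1 = #|K|.-1)%N by rewrite card_K subn1.
have q2 : (q - 2 = #|K|.-1.-1)%N by rewrite card_K; lia.
have qgt1 : (1 < q)%N by rewrite -card_K finNzRing_gt1.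
have pos m n : (3 <= q)%N -> (0 < (q - 2) ^ m * (q - 1) ^ n)%N.
  by move=> q3; rewrite muln_gt0 !expn_gt0; apply/andP; split; apply/orP; left; lia.
split.
- move=> ds q3; apply: is_minimum_distanceP; first exact: pos.
    by rewrite q1 q2; apply: extremal_codeword; lia.
  by move=> w Cw w0; rewrite q1 q2; case: (codeword_lower_bound d_le_s Cw w0).
- move=> sd ds q3; apply: is_minimum_distanceP; first exact: pos.
    (* Here k = s - d, and the exponent d is rewritten as s - k. *)
    rewrite q1 q2 -{3}(subKn d_le_s); apply: extremal_codeword; lia.
  by move=> w Cw w0; rewrite q1 q2; case: (codeword_lower_bound d_le_s Cw w0).
- move=> ds; apply: is_minimum_distanceP; first by rewrite expn_gt0; lia.
    have [|w Cw] := @extremal_codeword R K s d 0 (leq0n d); first by rewrite ds.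
    by rewrite expn0 mul1n subn0 -q1; exists w.
  (* For d = s the second bound has exponent 0 on q-2, hence equals (q-1)^s. *)
  move=> w Cw w0; case: (codeword_lower_bound d_le_s Cw w0) => _.
  by rewrite q1 ds subnn expn0 mul1n.
(* For q = 2 the torus is a single point, so the word of a monomial has weight 1. *)
move=> q_2; apply: is_minimum_distanceP => //.
  have [w Cw] := @extremal_codeword R K s d 0 (leq0n d) d_le_s.
  by rewrite card_K q_2 exp1n expn0 => wE; exists w.
by move=> w _; move/hamming_weight_gt0.
Qed.
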